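(* Let $(\vec X^h(t),\kappa_g^h(t)) \in \underline{V}^h\times W^h_{\partial_0}$, for $t\in(0,T]$, be a solution to the following semidiscrete scheme $(\mathcal{C}_h)^h$: given $\vec X^h(0)\in\underline{V}^h_{\partial_0}$, for $t\in(0,T]$ it holds that $\vec X^h_t(t)\in\mathbb{X}^h$ and $$\left(g(\vec X^h)\,\vec X^h_t,\chi\,\vec\nu^h\,|\vec X^h_\rho|\right)^h=\left(g^{\frac12}(\vec X^h)\,\kappa^h_g,\chi\,|\vec X^h_\rho|\right)^h\quad\forall\ \chi\in W^h_{\partial_0},$$ $$\left(g(\vec X^h)\,\kappa^h_g\,\vec\nu^h,\vec\eta\,|\vec X^h_\rho|\right)^h+\left(\nabla g^{\frac12}(\vec X^h),\vec\eta\,|\vec X^h_\rho|\right)^h+\left(g^{\frac12}(\vec X^h)\,\vec X^h_\rho,\vec\eta_\rho\,|\vec X^h_\rho|^{-1}\right)^h=0\quad\forall\ \vec\eta\in\mathbb{X}^h.$$ Then the solution satisfies $$\frac{\rm d}{{\rm d}t}L^h_g(\vec X^h(t))+\left(g^{\frac12}(\vec X^h)\,\kappa_g^h,\kappa_g^h\,|\vec X^h_\rho|\right)^h=0,$$ where $L^h_g(\vec Z)=\left(g^{\frac12}(\vec Z),|\vec Z_\rho|\right)^h$ for $\vec Z\in\underline{V}^h$.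
   Context: Metric: $H\subset\mathbb{R}^2$ is a domain and $g:H\to\mathbb{R}_{>0}$ is a smooth positive function. $\vec e_1,\vec e_2$ is the standard basis of $\mathbb{R}^2$; a dot between vectors is the Euclidean inner product; $\cdot^\perp$ is clockwise rotation by $\frac\pi2$. Parameter domain: either $I=\mathbb{R}/\mathbb{Z}$ (closed curve), with $\partial I=\emptyset$, or $I=(0,1)$ (open curve), with $\partial I=\{0,1\}$. $\partial I=\partial_0 I\cup\partial_1 I\cup\partial_2 I\cup\partial_D I$ is a given disjoint partition. The set $\partial_0 I$ may be nonempty only if $H=\{\vec z\in\mathbb{R}^2:\vec z\,.\,\vec e_1>0\}$ and either $g(\vec z)=(\vec z\,.\,\vec e_1)^{-2\mu}$ with $\mu\le-1$, or $g(\vec z)=(\vec z\,.\,\vec e_1)^{2(n-1)}e^{-\frac12|\vec z|^2}$ with an integer $n\ge2$; in these cases $g$ and $g^{\frac12}$ are extended $C^1$ up to the $x_2$-axis, where $g=0$, and curve endpoints belonging to $\partial_0 I$ lie on the $x_2$-axis. Finite element spaces: for an integer $J\ge3$, $h=J^{-1}$, $q_j=jh$, $I_j=[q_{j-1},q_j]$ (with $q_0$ and $q_J$ identified if $I=\mathbb{R}/\mathbb{Z}$). $V^h=\{\chi\in C(\overline I):\chi|_{I_j}\text{ affine},\ j=1,\dots,J\}$, $\underline{V}^h=[V^h]^2$, $W^h_{\partial_0}=\{\chi\in V^h:\chi(\rho)=0\ \forall\rho\in\partial_0I\}$, $\underline{V}^h_{\partial_0}=\{\vec\eta\in\underline{V}^h:\vec\eta(\rho)\,.\,\vec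 e_1=0\ \forall\rho\in\partial_0I\}$, and $\mathbb{X}^h=\{\vec\eta\in\underline{V}^h_{\partial_0}:\vec\eta=\vec0\text{ on }\partial_DI,\ \vec\eta\,.\,\vec e_i=0\text{ on }\partial_iI,\ i=1,2\}$. Mass-lumped inner product: for piecewise continuous $u,v$ with possible jumps at the nodes, $(u,v)^h=\frac12h\sum_{j=1}^J[(uv)(q_j^-)+(uv)(q_{j-1}^+)]$, where $\pm$ denotes one-sided limits; for vector-valued functions the product is the Euclidean inner product. Subscripts $\rho$, $t$ denote partial derivatives. $\vec\tau^h=\vec X^h_\rho/|\vec X^h_\rho|$, $\vec\nu^h=-(\vec\tau^h)^\perp$. A solution is understood to be differentiable in time, with $|\vec X^h_\rho|>0$ and $\vec X^h(\rho,t)\in H$ for $\rho\in\overline I\setminus\partial_0I$. *)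

(* Defs.v *)
From HB Require Import structures.
From mathcomp Require Import all_boot all_order all_algebra.
From mathcomp Require Import all_classical all_reals all_analysis.

Set Implicit Arguments.
Unset Strict Implicit.
Unset Printing Implicit Defensive.

Import Order.TTheory GRing.Theory Num.Theory.
Import numFieldNormedType.Exports.

Local Open Scope classical_set_scope.
Local Open Scope ring_scope.

(* The library norm on 'rV[R]_2 is the sup norm (same topology and derivatives);
   Euclidean lengths are therefore written with [enorm]. *)
Definition dotv {R : realType} (u v : 'rV[R]_2) : R :=
  \sum_(i < 2) u ord0 i * v ord0 i.

Definition enorm {R : realType} (u : 'rV[R]_2) : R := Num.sqrt (dotv u u).

(* vec e_1 = [bvec 0], vec e_2 = [bvec 1]. *)
Definition bvec {R : realType} (i : 'I_2) : 'rV[R]_2 := delta_mx ord0 i.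

Definition e1 {R : realType} : 'rV[R]_2 := bvec ord0.
Definition e2 {R : realType} : 'rV[R]_2 := bvec ord_max.

(* Clockwise rotation by pi/2: (x, y) |-> (y, -x). *)
Definition perp {R : realType} (u : 'rV[R]_2) : 'rV[R]_2 :=
  dotv u e2 *: e1 - dotv u e1 *: e2.

Definition is_domain {R : realType} (H : set 'rV[R]_2) : Prop :=
  [/\ open H, connected H & H !=set0].

Fixpoint iter_partial {R : realType} (s : seq 'I_2) (f : 'rV[R]_2 -> R) :
    'rV[R]_2 -> R :=
  if s is i :: s' then 'D_(bvec i) (iter_partial s' f) else f.

Definition smooth_on {R : realType} (H : set 'rV[R]_2) (f : 'rV[R]_2 -> R) :
    Prop :=
  forall (s : seq 'I_2) (z : 'rV[R]_2), H z ->
    differentiable (iter_partial s f) z.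

(* Gradient of f on the open set H, extended by continuity to the closure of H.
   For f of class C^1 on H it is the usual gradient at every point of H. *)
Definition gradient {R : realType} (H : set 'rV[R]_2) (f : 'rV[R]_2 -> R)
    (z : 'rV[R]_2) : 'rV[R]_2 :=
  \row_(i < 2) lim ('D_(bvec i) f y @[y --> within H (nbhs z)]).

Definition sqrtg {R : realType} (g : 'rV[R]_2 -> R) (z : 'rV[R]_2) : R :=
  Num.sqrt (g z).

(* Functions on closure(I) are functions on the real line of which only the
   restriction to [0, 1] matters; for I = R/Z they take the same value at 0
   and 1, which represent the same point. *)
Variant curve_kind : Set := closed_curve | open_curve.

Definition boundary {R : realType} (k : curve_kind) : set R :=
  if k is open_curve then [set 0; 1] else set0.

Definition bd_partition {R : realType} (k : curve_kind) (d0 d1 d2 dD : set R) :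
    Prop :=
  [/\ boundary k = d0 `|` d1 `|` d2 `|` dD,
      [/\ d0 `&` d1 = set0, d0 `&` d2 = set0 & d0 `&` dD = set0]
    & [/\ d1 `&` d2 = set0, d1 `&` dD = set0 & d2 `&` dD = set0]].

(* The metrics allowed when d0 is nonempty. The formulas are imposed on the
   closed half-plane, i.e. g is extended to the x_2-axis; both vanish there. *)
Definition axis_metric {R : realType} (H : set 'rV[R]_2) (g : 'rV[R]_2 -> R) :
    Prop :=
  H = [set z | 0 < dotv z e1] /\
  ((exists2 mu : R, mu <= -1 &
      forall z, 0 <= dotv z e1 -> g z = dotv z e1 `^ (- 2 * mu)) \/
   (exists2 n : nat, (2 <= n)%N &
      forall z, 0 <= dotv z e1 ->
        g z = dotv z e1 ^+ (2 * (n - 1)) * expR (- (2^-1 * enorm z ^+ 2)))).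

Definition node {R : realType} (J j : nat) : R := j%:R / J%:R.

Definition Vh {R : realType} (k : curve_kind) (J : nat) (chi : R -> R) : Prop :=
  [/\ {within `[0, 1], continuous chi},
      k = closed_curve -> chi 0 = chi 1
    & forall j, (j < J)%N -> exists a b : R,
        forall rho : R, rho \in `[node J j, node J j.+1] -> chi rho = a * rho + b].

Definition vecVh {R : realType} (k : curve_kind) (J : nat)
    (eta : R -> 'rV[R]_2) : Prop :=
  forall i : 'I_2, Vh k J (fun rho => eta rho ord0 i).

Definition Wh0 {R : realType} (k : curve_kind) (J : nat) (d0 : set R)
    (chi : R -> R) : Prop :=
  Vh k J chi /\ forall rho, d0 rho -> chi rho = 0.

Definition vecVh0 {R : realType} (k : curve_kind) (J : nat) (d0 : set R)
    (eta : R -> 'rV[R]_2) : Prop :=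
  vecVh k J eta /\ forall rho, d0 rho -> dotv (eta rho) e1 = 0.

Definition Xh {R : realType} (k : curve_kind) (J : nat) (d0 d1 d2 dD : set R)
    (eta : R -> 'rV[R]_2) : Prop :=
  [/\ vecVh0 k J d0 eta,
      forall rho, dD rho -> eta rho = 0,
      forall rho, d1 rho -> dotv (eta rho) e1 = 0
    & forall rho, d2 rho -> dotv (eta rho) e2 = 0].

(* [ml J w] is (u, v)^h for the pointwise product w = uv. All the products
   below are taken with one-sided limits at the nodes, so the value of a
   rho-derivative at a node (where it may jump) is irrelevant. *)
Definition ml {R : realType} (J : nat) (w : R -> R) : R :=
  2^-1 * J%:R^-1 *
  \sum_(0 <= j < J)
    (lim (w rho @[rho --> (node J j.+1)^'-]) +
     lim (w rho @[rho --> (node J j)^'+])).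

Definition mls {R : realType} (J : nat) (u v : R -> R) : R :=
  ml J (fun rho => u rho * v rho).

Definition mlv {R : realType} (J : nat) (u v : R -> 'rV[R]_2) : R :=
  ml J (fun rho => dotv (u rho) (v rho)).

(* |Z_rho|, tau and nu of a parametrization Z. *)
Definition speed {R : realType} (Z : R -> 'rV[R]_2) (rho : R) : R :=
  enorm (derive1 Z rho).

Definition tau {R : realType} (Z : R -> 'rV[R]_2) (rho : R) : 'rV[R]_2 :=
  (speed Z rho)^-1 *: derive1 Z rho.

Definition nu {R : realType} (Z : R -> 'rV[R]_2) (rho : R) : 'rV[R]_2 :=
  - perp (tau Z rho).

Definition Lhg {R : realType} (J : nat) (g : 'rV[R]_2 -> R)
    (Z : R -> 'rV[R]_2) : R :=
  mls J (fun rho => sqrtg g (Z rho)) (speed Z).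

(* Time derivatives on [0, T]: two-sided for 0 < t < T, from the left at T. *)
Definition tquot {R : realType} {V : normedModType R} (T : R) (f : R -> V)
    (t : R) : set_system V :=
  (s - t)^-1 *: (f s - f t) @[s --> within `[0, T] t^'].

Definition tderivable {R : realType} {V : normedModType R} (T : R)
    (f : R -> V) (t : R) : Prop :=
  cvg (tquot T f t).

Definition tderiv {R : realType} {V : normedModType R} (T : R) (f : R -> V)
    (t : R) : V :=
  lim (tquot T f t).

(* X_t (t) as a function of rho, for X indexed by time first. *)
Definition Xt {R : realType} (T : R) (X : R -> R -> 'rV[R]_2) (t rho : R) :
    'rV[R]_2 :=
  tderiv T (fun s => X s rho) t.

(* sol_init_cont says that X attains its initial value. Together with sol_init
   and sol_Xt it keeps the endpoints in d0 on the x_2-axis for all t. *)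
Record scheme_solution {R : realType} (H : set 'rV[R]_2) (g : 'rV[R]_2 -> R)
    (k : curve_kind) (d0 d1 d2 dD : set R) (J : nat) (T : R)
    (X : R -> R -> 'rV[R]_2) (kappa : R -> R -> R) : Prop := SchemeSolution {
  sol_init : vecVh0 k J d0 (X 0);
  sol_init_cont : forall rho : R, rho \in `[0, 1] ->
    X s rho @[s --> 0^'+] --> X 0 rho;
  sol_X : forall t : R, 0 < t <= T -> vecVh k J (X t);
  sol_kappa : forall t : R, 0 < t <= T -> Wh0 k J d0 (kappa t);
  sol_diff : forall t rho : R, 0 < t <= T -> rho \in `[0, 1] ->
    tderivable T (fun s => X s rho) t;
  sol_in_H : forall t rho : R, 0 < t <= T -> rho \in `[0, 1] -> ~ d0 rho ->
    H (X t rho);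
  sol_regular : forall (t : R) (j : nat) (rho : R), 0 < t <= T -> (j < J)%N ->
    rho \in `]node J j, node J j.+1[ -> 0 < speed (X t) rho;
  sol_Xt : forall t : R, 0 < t <= T -> Xh k J d0 d1 d2 dD (Xt T X t);
  sol_normal : forall t : R, 0 < t <= T -> forall chi, Wh0 k J d0 chi ->
    mlv J (fun rho => g (X t rho) *: Xt T X t rho)
          (fun rho => (chi rho * speed (X t) rho) *: nu (X t) rho) =
    mls J (fun rho => sqrtg g (X t rho) * kappa t rho)
          (fun rho => chi rho * speed (X t) rho);
  sol_curvature : forall t : R, 0 < t <= T ->
    forall eta, Xh k J d0 d1 d2 dD eta ->
    mlv J (fun rho => (g (X t rho) * kappa t rho) *: nu (X t) rho)
          (fun rho => speed (X t) rho *: eta rho) +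
    mlv J (fun rho => gradient H (sqrtg g) (X t rho))
          (fun rho => speed (X t) rho *: eta rho) +
    mlv J (fun rho => sqrtg g (X t rho) *: derive1 (X t) rho)
          (fun rho => (speed (X t) rho)^-1 *: derive1 eta rho) = 0
}.

(* Main.v *)
Require Import Defs.
From HB Require Import structures.
From mathcomp Require Import all_boot all_order all_algebra.
From mathcomp Require Import all_classical all_reals all_analysis.
From mathcomp Require Import ring.
Import Order.TTheory GRing.Theory Num.Theory.
Import numFieldNormedType.Exports.
Set Implicit Arguments.
Unset Strict Implicit.
Unset Printing Implicit Defensive.
Local Open Scope classical_set_scope.
Local Open Scope ring_scope.

(** The identity is the scheme tested with the right functions. Testing the
    first equation with kappa and the second one with X_t, the two products
    that contain the normal are the same, so the second equation becomes

      (g^(1/2) kappa, kappa |X_rho|)^h + (grad g^(1/2), X_t |X_rho|)^h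
        + (g^(1/2) X_rho, X_rho t / |X_rho|)^h = 0         [energy_identity]

    and it remains to see that the last two products are the time derivative
    of L^h_g(X) [Lhg_tquot].

    Every mass-lumped product is a finite sum over the end points of the
    elements [ml_nodal], because X is affine on each element, with constant
    X_rho there [vecVh_derive1], and because g^(1/2) and its gradient are
    continuous along the curve up to the nodes. In particular L^h_g(X(t)) is an
    explicit function of the finitely many node positions [Lhg_nodal]:
    differentiating it by the product and chain rules gives, on each element,
    one term from the weight, with grad g^(1/2) . X_t at the nodes
    [gradient_term_nodal], and one from the length of the slope, with
    X_rho . X_rho t / |X_rho| [stiffness_term_nodal].

    Two points need care. First, at t = T only the left derivative exists;
    trajectories are continued past T by their tangent, after which the
    two-sided calculus applies [is_derive_ext]. Secondly, end points in d0 lie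
    on the axis, where g^(1/2) vanishes and need not be differentiable. Such a
    point stays on the axis, because the first component of its velocity
    vanishes [d0_axis], so that g^(1/2) is constantly 0 along its trajectory.
    Correspondingly grad g^(1/2) . X_t = 0 there: both admitted metrics satisfy
    g^(1/2) = x^p exp(c |z|^2) with p >= 1, x the distance to the axis
    [axis_metric_sqrtg], so the gradient has a limit on the axis, and this
    limit has no tangential component [derive_sqrtg_cvg_axis]. *)

(** * The plane *)

Lemma dotvC (R : realType) (u v : 'rV[R]_2) : dotv u v = dotv v u.
Proof. by apply: eq_bigr => i _; rewrite mulrC. Qed.

Lemma dotvZl (R : realType) (a : R) (u v : 'rV[R]_2) :
  dotv (a *: u) v = a * dotv u v.
Proof. by rewrite mulr_sumr; apply: eq_bigr => i _; rewrite mxE mulrA. Qed.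

Lemma dotvZr (R : realType) (a : R) (u v : 'rV[R]_2) :
  dotv u (a *: v) = a * dotv u v.
Proof. by rewrite dotvC dotvZl dotvC. Qed.

Lemma dotvDl (R : realType) (u v w : 'rV[R]_2) :
  dotv (u + v) w = dotv u w + dotv v w.
Proof. by rewrite -big_split; apply: eq_bigr => i _; rewrite mxE mulrDl. Qed.

Lemma dotv_ge0 (R : realType) (u : 'rV[R]_2) : 0 <= dotv u u.
Proof. by apply: sumr_ge0 => i _; rewrite -expr2 sqr_ge0. Qed.

Lemma dotv_bvec (R : realType) (u : 'rV[R]_2) (i : 'I_2) :
  dotv u (bvec i) = u ord0 i.
Proof.
rewrite /dotv (bigD1 i) //= mxE !eqxx mulr1 big1 ?addr0// => j ji.
by rewrite mxE (negPf ji) andbF mulr0.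
Qed.

Lemma dotv_e1 (R : realType) (u : 'rV[R]_2) : dotv u e1 = u ord0 ord0.
Proof. exact: dotv_bvec. Qed.

Lemma rV2_bvec (R : realType) (v : 'rV[R]_2) :
  v = \sum_(i < 2) v ord0 i *: bvec i.
Proof. by rewrite {1}[v]row_sum_delta. Qed.

Lemma cvg_dotv (R : realType) (T : Type) (F : set_system T) (FF : Filter F)
    (u v : T -> 'rV[R]_2) (a b : 'rV[R]_2) :
  (forall i, u x ord0 i @[x --> F] --> a ord0 i) ->
  (forall i, v x ord0 i @[x --> F] --> b ord0 i) ->
  dotv (u x) (v x) @[x --> F] --> dotv a b.
Proof.
by move=> ua vb; apply: cvg_big => [|i _]; [exact: add_continuous|exact: cvgM].
Qed.

Lemma cvg_coord (R : realType) (T : Type) (F : set_system T) (FF : Filter F)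
    (u : T -> 'rV[R]_2) (a : 'rV[R]_2) (i : 'I_2) :
  u x @[x --> F] --> a -> u x ord0 i @[x --> F] --> a ord0 i.
Proof.
move=> ua.
exact: (@cvg_comp _ _ _ u (fun M => M ord0 i) _ _ _ ua (@coord_continuous _ _ _ _ _ _)).
Qed.

Lemma cvg_rV2 (R : realType) (T : Type) (F : set_system T) (FF : Filter F)
    (u : T -> 'rV[R]_2) (a : 'rV[R]_2) :
  (forall i, u x ord0 i @[x --> F] --> a ord0 i) -> u x @[x --> F] --> a.
Proof.
move=> ua; rewrite (rV2_bvec a) (_ : u = fun x => \sum_(i < 2) u x ord0 i *: bvec i).
  apply: cvg_big => [|i _]; first exact: add_continuous.
  by exact: cvgZ (ua i) (cvg_cst _).
by apply/funext => x; exact: rV2_bvec.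
Qed.

Lemma cvg_near_eq (T : Type) (U : nbhsType) (F : set_system T)
    (FF : Filter F) (f h : T -> U) (l : U) :
  (\forall x \near F, h x = f x) -> h x @[x --> F] --> l ->
  f x @[x --> F] --> l.
Proof. by move=> hf; apply: cvg_trans; exact: near_eq_cvg. Qed.

(** Restricting to the line through x in direction v reduces the claim to the
    chain rule on the real line. *)
Lemma is_derive_chain (R : realType) (V : normedModType R) (f : V -> R)
    (h : R -> R) (x v : V) (df dh : R) :
  is_derive x v f df -> is_derive (f x) 1 h dh ->
  is_derive x v (fun y => h (f y)) (dh * df).
Proof.
move=> [/derivable1P f1 fE] hd.
have lineE (k : V -> R) : 'D_v k x = 'D_1 (fun s : R => k (s *: v + x)) 0.
  rewrite /derive; set k1 := fun h => h^-1 *: _; set k2 := fun h => h^-1 *: _.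
  suff -> : k1 = k2 by [].
  by apply/funext => s; rewrite /k1 /k2 /= addr0 scale0r add0r [_%:A]mulr1.
have fl : is_derive (0 : R) (1 : R) (fun s : R => f (s *: v + x)) df.
  by rewrite -fE lineE; exact: DeriveDef.
have hd' : is_derive ((fun s : R => f (s *: v + x)) 0) 1 h dh.
  by rewrite scale0r add0r.
have [d dE] := @is_derive1_comp _ h (fun s : R => f (s *: v + x)) 0 _ _ hd' fl.
by split; [exact/derivable1P|rewrite lineE].
Qed.

Lemma derive_sum_bvec (R : realType) (f : 'rV[R]_2 -> R) (z v : 'rV[R]_2) :
  differentiable f z -> 'D_v f z = \sum_(i < 2) v ord0 i * 'D_(bvec i) f z.
Proof.
move=> df; rewrite deriveE// {1}(rV2_bvec v) linear_sum.
by apply: eq_bigr => i _; rewrite linearZ/= -deriveE.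
Qed.

(** * One-sided time derivatives *)

(** Outside [0, T] the function is continued by its tangent at t. The
    one-sided derivative of f at t = T thereby becomes an ordinary derivative of
    the extension, and the rules below are those of the two-sided calculus. *)
Definition tangent_ext (R : realType) (V : normedModType R) (T : R) (f : R -> V)
    (t : R) (l : V) (s : R) : V :=
  if 0 <= s <= T then f s else f t + (s - t) *: l.

Section tquot.
Context {R : realType}.
Variables (T t : R).
Hypothesis tT : 0 < t <= T.

Lemma tangent_extE (V : normedModType R) (f : R -> V) l s : 0 <= s <= T ->
  tangent_ext T f t l s = f s.
Proof. by rewrite /tangent_ext => ->. Qed.

Lemma tangent_ext_t (V : normedModType R) (f : R -> V) l : tangent_ext T f t l t = f t.
Proof. by rewrite tangent_extE//; case/andP: tT => /ltW -> ->. Qed.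

Lemma is_derive_tquot (V : normedModType R) (F : R -> V) (l : V) :
  is_derive t 1 F l <-> (s - t)^-1 *: (F s - F t) @[s --> t^'] --> l.
Proof.
have shift_dnbhs (x y : R) : (h + (y - x)) @[h --> x^'] --> y^'.
  move=> A Ay.
  have {}Ay : \forall s \near y, s != y -> A s by exact: Ay.
  rewrite (near_shift x) in Ay.
  apply: filterS Ay => h /= Ah hx; apply: Ah; apply: contra hx => /eqP /= hy.
  by rewrite -subr_eq0; apply/eqP; rewrite -[0](subrr y) -[X in _ = X - _]hy; ring.
have to_t : (h + t) @[h --> (0 : R)^'] --> t^'.
  by have := shift_dnbhs 0 t; rewrite subr0.
have to_0 : (s - t) @[s --> t^'] --> (0 : R)^'.
  by have := shift_dnbhs t 0; rewrite sub0r.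
split.
  move=> [/cvg_ex[l' d] dE].
  have El : l' = l by rewrite -dE; apply/esym/cvg_lim.
  rewrite -El.
  have := cvg_comp _ _ to_0 d; apply: cvg_trans; apply: near_eq_cvg.
  by near=> s => /=; rewrite [_%:A]mulr1 subrK.
move=> d.
have d' : h^-1 *: ((F \o shift t) (h *: 1) - F t) @[h --> 0^'] --> l.
  have := cvg_comp _ _ to_t d; apply: cvg_trans; apply: near_eq_cvg.
  by near=> s => /=; rewrite [_%:A]mulr1 addrK.
by split; [apply/cvg_ex; exists l|exact: cvg_lim].
Unshelve. all: by end_near. Qed.

Lemma is_derive_ext (V : normedModType R) (f : R -> V) (l : V) :
  tquot T f t --> l -> is_derive t 1 (tangent_ext T f t l) l.
Proof.
move=> fl; apply/is_derive_tquot; rewrite tangent_ext_t.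
apply/cvgrPdist_lt => e e0.
have H := (cvgrPdist_lt _ _).1 fl e e0.
have {}H : \forall s \near t^', `[0, T]%classic s ->
    `|l - (s - t)^-1 *: (f s - f t)| < e by exact: H.
near=> s.
have st : s != t by near: s; exact: nbhs_dnbhs_neq.
rewrite /tangent_ext; case: ifPn => sT.
  by have := near H s; apply => //; rewrite /= in_itv.
rewrite addrAC subrr add0r scalerA mulVf ?scale1r ?subrr ?normr0//.
by rewrite subr_eq0.
Unshelve. all: by end_near. Qed.

(** The value of f at time 0 is left free, because the scheme is imposed for
    positive times only; t > 0 keeps it away from the quotient. *)
Lemma tquot_restrict (V : normedModType R) (F f : R -> V) (l : V) :
  is_derive t 1 F l -> (forall s, 0 < s <= T -> f s = F s) ->
  tquot T f t --> l.
Proof.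
move=> /is_derive_tquot dF fF.
have dF' : (s - t)^-1 *: (F s - F t) @[s --> within `[0, T] t^'] --> l.
  exact: cvg_within_filter.
apply: cvg_trans dF'; apply: near_eq_cvg; rewrite near_withinE.
near=> s => /=; rewrite in_itv/= => /andP[s0 sT].
have sp : 0 < s by near: s; apply: nbhs_dnbhs; apply: lt_nbhsr; case/andP: tT.
by rewrite !fF// sp.
Unshelve. all: by end_near. Qed.

(** Times t - m with small m > 0 are always available, also when t = T; hence
    the limits that define time derivatives are unique. *)
Lemma tquot_proper : ProperFilter (within `[0, T] t^').
Proof.
apply: Build_ProperFilter_ex => P [e /= e0 tP].
have [t0 tT'] := andP tT.
have m0 : 0 < Num.min t (e / 2) by rewrite lt_min t0 divr_gt0.
have mt : Num.min t (e / 2) <= t by rewrite ge_min lexx.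
have me : Num.min t (e / 2) < e.
  by rewrite gt_min ltr_pdivrMr// ltr_pMr// ltr1n orbT.
exists (t - Num.min t (e / 2)); apply: tP => /=.
- by rewrite opprB addrC subrK gtr0_norm.
- by rewrite lt_eqF// gtrBl.
- by rewrite in_itv/= subr_ge0 mt (le_trans _ tT')// gerBl ltW.
Qed.

Lemma tquot_uniq (V : normedModType R) (f : R -> V) (l : V) :
  tquot T f t --> l -> tderivable T f t /\ tderiv T f t = l.
Proof.
move=> fl; have PF := tquot_proper; split; first by apply/cvg_ex; exists l.
exact: cvg_lim.
Qed.

End tquot.

Section tquot_rules.
Context {R : realType}.

Lemma is_derive_coord (F : R -> 'rV[R]_2) (t : R) l i :
  is_derive t 1 F l -> is_derive t 1 (fun s => F s ord0 i) (l ord0 i).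
Proof.
move=> [dF <-]; have := dF; move/derivable_mxP => /(_ ord0 i) di.
by split=> //; rewrite derive_mx// mxE.
Qed.

Variables (T t : R).
Hypothesis tT : 0 < t <= T.

Lemma tquot_coord (f : R -> 'rV[R]_2) (l : 'rV[R]_2) i : tquot T f t --> l ->
  tquot T (fun s => f s ord0 i) t --> l ord0 i.
Proof.
move=> fl; have d := is_derive_coord i (is_derive_ext tT fl).
apply: (tquot_restrict tT d) => s /andP[/ltW s0 sT].
by rewrite tangent_extE// s0.
Qed.

Lemma tquotM (f h : R -> R) (a b : R) : tquot T f t --> a -> tquot T h t --> b ->
  tquot T (fun s => f s * h s) t --> f t * b + h t * a.
Proof.
move=> fa hb.
have d := is_deriveM (is_derive_ext tT fa) (is_derive_ext tT hb).
rewrite !(tangent_ext_t tT) in d.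
apply: (tquot_restrict tT d) => s /andP[/ltW s0 sT].
by rewrite /= fctE !tangent_extE// s0.
Qed.

Lemma tquot_sum (V : normedModType R) n (f : 'I_n -> R -> V) (l : 'I_n -> V) :
  (forall i, tquot T (f i) t --> l i) ->
  tquot T (fun s => \sum_(i < n) f i s) t --> \sum_(i < n) l i.
Proof.
move=> fl; have d := is_derive_sum (fun i => is_derive_ext tT (fl i)).
apply: (tquot_restrict tT d) => s /andP[/ltW s0 sT].
by rewrite fct_sumE; apply: eq_bigr => i _; rewrite tangent_extE// s0.
Qed.

Lemma tquotD (V : normedModType R) (f h : R -> V) (a b : V) :
  tquot T f t --> a -> tquot T h t --> b ->
  tquot T (fun s => f s + h s) t --> a + b.
Proof.
move=> fa hb.
have d := is_deriveD (is_derive_ext tT fa) (is_derive_ext tT hb).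
apply: (tquot_restrict tT d) => s /andP[/ltW s0 sT].
rewrite -[RHS]/(tangent_ext T f t a s + tangent_ext T h t b s).
by rewrite !tangent_extE// s0.
Qed.

Lemma tquotZ (V : normedModType R) c (f : R -> V) (a : V) :
  tquot T f t --> a -> tquot T (fun s => c *: f s) t --> c *: a.
Proof.
move=> fa; have d := is_deriveZ c (is_derive_ext tT fa).
apply: (tquot_restrict tT d) => s /andP[/ltW s0 sT].
by rewrite -[RHS]/(c *: tangent_ext T f t a s) tangent_extE// s0.
Qed.

Lemma tquot_enorm (f : R -> 'rV[R]_2) v : 0 < enorm (f t) ->
  tquot T f t --> v ->
  tquot T (fun s => enorm (f s)) t --> (enorm (f t))^-1 * dotv (f t) v.
Proof.
move=> f0 fv; have ff0 : 0 < dotv (f t) (f t) by rewrite -sqrtr_gt0.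
have dd : tquot T (fun s => dotv (f s) (f s)) t --> dotv (f t) v + dotv (f t) v.
  rewrite -big_split; apply: tquot_sum => i.
  by apply: tquotM; exact: tquot_coord.
have dD := is_derive_ext tT dd.
have ff0' : 0 < tangent_ext T (fun s => dotv (f s) (f s)) t (dotv (f t) v + dotv (f t) v) t.
  by rewrite tangent_ext_t.
have d := is_derive_chain dD (is_derive1_sqrt ff0').
have -> : (enorm (f t))^-1 * dotv (f t) v = (2 * Num.sqrt (dotv (f t) (f t)))^-1
     * (dotv (f t) v + dotv (f t) v).
  have := gt_eqF f0; rewrite /enorm; set q := Num.sqrt _ => /negbT q0.
  by field.
rewrite tangent_ext_t// in d.
apply: (tquot_restrict tT d) => s /andP[/ltW s0 sT].
by rewrite /enorm tangent_extE// s0.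
Qed.

End tquot_rules.

(** The mean value theorem on [0, t]: the extension by the tangent gives left
    continuity at t; right continuity at 0 is assumed, since nothing is known
    about the derivative there. *)
Lemma tquot0_constant (R : realType) (T t : R) (f : R -> R) : 0 < t <= T ->
  (forall s, 0 < s <= T -> tquot T f s --> (0 : R)) ->
  f s @[s --> 0^'+] --> f 0 -> f t = f 0.
Proof.
move=> /andP[t0 tT] df f0.
have d s : s \in `]0, t[ -> is_derive s 1 f (cst 0 s).
  rewrite in_itv/= => /andP[s0 st]; have sT : s < T by exact: lt_le_trans tT.
  apply: near_eq_is_derive (is_derive_ext _ (df s _)); rewrite ?s0 ?ltW//.
  near=> r; rewrite tangent_extE//; apply/andP; split; apply: ltW; near: r.
    exact: lt_nbhsr.
  exact: lt_nbhsl.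
have [|c _] := MVT t0 d; last by rewrite mul0r => /eqP; rewrite subr_eq0 => /eqP.
apply/(continuous_within_itvP _ t0); split=> //.
  move=> s st; apply: differentiable_continuous.
  by apply/derivable1_diffP; case: (d s st).
have dt : is_derive t 1 (tangent_ext T f t 0) (0 : R).
  by apply: is_derive_ext; [|apply: df]; rewrite t0.
have ct : tangent_ext T f t 0 s @[s --> t^'-] --> tangent_ext T f t 0 t.
  apply: cvg_within_filter; apply: differentiable_continuous.
  by apply/derivable1_diffP; case: dt.
rewrite tangent_ext_t ?t0// in ct.
apply: (@cvg_near_eq _ _ t^'-) ct; near=> s; rewrite tangent_extE//.
apply/andP; split.
  by apply: ltW; near: s; exact: nbhs_left_gt.
by apply: le_trans tT; apply: ltW.
Unshelve. all: by end_near. Qed.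

(** * Mass lumping over the elements *)

(** An abstraction of the right-hand limit at the left node and of the left-hand
    limit at the right node of an element, so that each integrand is analysed
    once. *)
Definition elt_side (R : realType) (J j : nat) (p : R) (F : set_system R) :=
  [/\ ProperFilter F, F --> p,
      \forall rho \near F, rho \in `]node J j, node J j.+1[
    & p \in [:: node J j; node J j.+1]].

Definition slope (R : realType) (J j : nat) (Z : R -> 'rV[R]_2) : 'rV[R]_2 :=
  J%:R *: (Z (node J j.+1) - Z (node J j)).

Section elements.
Context {R : realType}.
Variable J : nat.
Hypothesis J_gt0 : (0 < J)%N.

Lemma node_ltS j : node J j < node J j.+1 :> R.
Proof. by rewrite /node ltr_pM2r ?invr_gt0 ?ltr0n// ltr_nat. Qed.

Lemma node_itv j : (j <= J)%N -> (node J j : R) \in `[0, 1].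
Proof.
move=> jJ; rewrite in_itv/= /node divr_ge0//=.
by rewrite ler_pdivrMr ?ltr0n// mul1r ler_nat.
Qed.

Lemma elt_itv01 j (rho : R) : (j < J)%N ->
  rho \in `]node J j, node J j.+1[ -> 0 < rho < 1.
Proof.
move=> jJ; rewrite in_itv/= => /andP[r0 r1].
have := node_itv (ltnW jJ); rewrite in_itv/= => /andP[n0 _].
have := node_itv jJ; rewrite in_itv/= => /andP[_ n1].
by rewrite (le_lt_trans n0 r0) (lt_le_trans r1 n1).
Qed.

Lemma right_elt_side j : elt_side J j (node J j : R) (node J j)^'+.
Proof.
split; last by rewrite inE eqxx.
- exact: at_right_proper_filter.
- exact: cvg_within.
near=> r; rewrite in_itv/=; apply/andP; split=> //; near: r.
exact: nbhs_right_lt (node_ltS j).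
Unshelve. all: by end_near. Qed.

Lemma left_elt_side j : elt_side J j (node J j.+1 : R) (node J j.+1)^'-.
Proof.
split; last by rewrite !inE eqxx orbT.
- exact: at_left_proper_filter.
- exact: cvg_within.
near=> r; rewrite in_itv/=; apply/andP; split=> //; near: r.
exact: nbhs_left_gt (node_ltS j).
Unshelve. all: by end_near. Qed.

Lemma elt_side_closed {j} {p : R} {F} : elt_side J j p F ->
  p \in `[node J j, node J j.+1].
Proof.
have n := ltW (node_ltS j).
by case=> _ _ _; rewrite in_cons mem_seq1 => /orP[] /eqP ->; rewrite in_itv/= lexx ?n.
Qed.

Lemma elt_side_itv01 {j} {p : R} {F} : (j < J)%N -> elt_side J j p F ->
  p \in `[0, 1].
Proof.
move=> jJ /elt_side_closed; rewrite !in_itv/= => /andP[r0 r1].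
have := node_itv (ltnW jJ); rewrite in_itv/= => /andP[n0 _].
have := node_itv jJ; rewrite in_itv/= => /andP[_ n1].
by rewrite (le_trans n0 r0) (le_trans r1 n1).
Qed.

(** Only limits from inside the elements enter a mass-lumped product; l j is
    the continuous representative of w on the closed element j, which need not
    agree with the one on a neighbouring element at the common node. *)
Lemma ml_nodal (w : R -> R) (l : nat -> R -> R) :
  (forall j p F, (j < J)%N -> elt_side J j p F -> w rho @[rho --> F] --> l j p) ->
  ml J w = 2^-1 * J%:R^-1 *
    \sum_(0 <= j < J) (l j (node J j.+1) + l j (node J j)).
Proof.
move=> wl; rewrite /ml; congr (_ * _); rewrite !big_nat.
apply: eq_bigr => j /andP[_ jJ]; congr (_ + _); apply: cvg_lim => //.
  exact: wl (left_elt_side j).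
exact: wl (right_elt_side j).
Qed.

Variable k : curve_kind.

Lemma Vh_cvg (chi : R -> R) j p F : (j < J)%N -> Vh k J chi ->
  elt_side J j p F -> chi rho @[rho --> F] --> chi p.
Proof.
move=> jJ [_ _ /(_ j jJ)[a [b aff]]] side.
rewrite aff; last exact: elt_side_closed side.
case: side => PF Fp near_elt _.
have l : a * rho + b @[rho --> F] --> a * p + b.
  by apply: cvgD; [apply: cvgM => //; exact: cvg_cst|exact: cvg_cst].
apply: cvg_trans l; apply: near_eq_cvg.
apply: filterS near_elt => r; rewrite in_itv/= => /andP[r0 r1].
by rewrite aff// in_itv/= !ltW.
Qed.

Lemma vecVh_cvg (Z : R -> 'rV[R]_2) j p F : (j < J)%N -> vecVh k J Z ->
  elt_side J j p F -> Z rho @[rho --> F] --> Z p.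
Proof.
move=> jJ ZV side; have [PF _ _ _] := side.
by apply: cvg_rV2 => i; exact: Vh_cvg (ZV i) side.
Qed.

Lemma vecVh_derive1 (Z : R -> 'rV[R]_2) j rho : (j < J)%N -> vecVh k J Z ->
  rho \in `]node J j, node J j.+1[ -> derive1 Z rho = slope J j Z.
Proof.
move=> jJ ZV rj.
have affine : exists a b : 'rV[R]_2,
    forall r : R, r \in `[node J j, node J j.+1] -> Z r = r *: a + b.
  have ab i := let: And3 _ _ H := ZV i in H j jJ.
  have [a aP] := choice ab; have [b bP] := choice aP.
  exists (\row_i a i), (\row_i b i) => r rj'.
  by apply/rowP => i; rewrite !mxE (bP i)// mulrC.
have [a [b Zab]] := affine.
have -> : slope J j Z = a.
  rewrite /slope !Zab ?in_itv/= ?lexx ?(ltW (node_ltS j))//.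
  rewrite opprD addrACA subrr addr0 -scalerBl scalerA -[RHS]scale1r.
  congr (_ *: _); rewrite /node -[in LHS]mulrBl -natrB// subSnn mul1r mulfV//.
  by rewrite pnatr_eq0 -lt0n.
rewrite derive1E.
have d : is_derive rho (1 : R) (fun r : R => r *: a + b) a.
  apply/is_derive_tquot; apply: cvg_near_cst; near=> r.
  rewrite opprD addrACA subrr addr0 -scalerBl scalerA mulVf ?scale1r//.
  by rewrite subr_eq0; near: r; exact: nbhs_dnbhs_neq.
have near_elt : \near rho, rho *: a + b = Z rho.
  move: (rj); rewrite in_itv/= => /andP[r0 r1].
  near=> r; rewrite Zab// in_itv/=; apply/andP; split; apply: ltW; near: r.
    exact: lt_nbhsr.
  exact: lt_nbhsl.
by have [_ ->] := near_eq_is_derive near_elt d.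
Unshelve. all: by end_near. Qed.

End elements.

(** * The weight g^(1/2) inside H and on the axis *)

(** The places where a node of the curve can be: inside H, or on the axis when
    the metric is one of those that degenerate there. *)
Definition admissible (R : realType) (H : set 'rV[R]_2) (g : 'rV[R]_2 -> R)
    (z : 'rV[R]_2) :=
  H z \/ (axis_metric H g /\ dotv z e1 = 0).

Section interior.
Context {R : realType}.
Variables (H : set 'rV[R]_2) (g : 'rV[R]_2 -> R).
Hypotheses (openH : open H) (g_gt0 : forall z, H z -> 0 < g z).
Hypothesis (g_smooth : smooth_on H g).

Lemma sqrtg_differentiable z : H z -> differentiable (sqrtg g) z.
Proof.
move=> Hz; apply: differentiable_comp; first exact: (g_smooth [::]).
by apply/derivable1_diffP; have [] := is_derive1_sqrt (g_gt0 Hz).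
Qed.

Lemma derive_sqrtg z v : H z ->
  'D_v (sqrtg g) z = (2 * sqrtg g z)^-1 * 'D_v g z.
Proof.
move=> Hz; have dg : is_derive z v g ('D_v g z).
  by apply/derivableP/diff_derivable; exact: (g_smooth [::]).
by have [_ ->] := is_derive_chain dg (is_derive1_sqrt (g_gt0 Hz)).
Qed.

Lemma derive_sqrtg_cvg z i : H z ->
  'D_(bvec i) (sqrtg g) y @[y --> z] --> 'D_(bvec i) (sqrtg g) z.
Proof.
move=> Hz; rewrite derive_sqrtg//.
have l : (2 * sqrtg g y)^-1 * 'D_(bvec i) g y @[y --> z]
    --> (2 * sqrtg g z)^-1 * 'D_(bvec i) g z.
  apply: (@cvgM _ _ (nbhs z) _); last exact: differentiable_continuous (g_smooth [:: i] Hz).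
  apply: cvgV; first by rewrite mulf_neq0// gt_eqF// sqrtr_gt0 g_gt0.
  apply: (@cvgM _ _ (nbhs z) _); first exact: cvg_cst.
  exact: differentiable_continuous (sqrtg_differentiable Hz).
apply: (@cvg_near_eq _ _ (nbhs z)) l; near=> y.
by rewrite derive_sqrtg//; near: y; exact: open_nbhs_nbhs.
Unshelve. all: by end_near. Qed.

Lemma within_open_proper z : H z -> ProperFilter (within H (nbhs z)).
Proof.
by move=> Hz; apply: Build_ProperFilter_ex => P /nbhs_singleton/= zP; exists z; apply: zP.
Qed.

(** The gradient of the scheme is defined by a limit from inside H; in the open
    set H it agrees with the partial derivatives because these are
    continuous. *)
Lemma gradient_sqrtgE z i : H z ->
  gradient H (sqrtg g) z ord0 i = 'D_(bvec i) (sqrtg g) z.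
Proof.
move=> Hz; have PF := within_open_proper Hz; rewrite mxE; apply: cvg_lim => //.
by apply: cvg_within_filter; exact: derive_sqrtg_cvg.
Qed.

Lemma gradient_sqrtg_cvg z i :
  cvg ('D_(bvec i) (sqrtg g) y @[y --> within H (nbhs z)]) ->
  gradient H (sqrtg g) y ord0 i @[y --> within H (nbhs z)] -->
    gradient H (sqrtg g) z ord0 i.
Proof.
move=> l; rewrite mxE; apply: (@cvg_near_eq _ _ (within H (nbhs z))) l.
by rewrite near_withinE; near=> y => Hy; rewrite gradient_sqrtgE.
Unshelve. all: by end_near. Qed.

End interior.

Section axis.
Context {R : realType}.
Variables (H : set 'rV[R]_2) (g : 'rV[R]_2 -> R).
Hypotheses (openH : open H) (axm : axis_metric H g).

(** A common form for the two admitted families: p = - mu, c = 0 for the power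
    metrics, and p = n - 1, c = - 1/4 for the Gaussian ones. The bounds on mu and
    n say exactly that p >= 1. *)
Lemma axis_metric_sqrtg : exists p c : R, 1 <= p /\
  forall z, 0 <= dotv z e1 ->
    sqrtg g z = dotv z e1 `^ p * expR (c * dotv z z).
Proof.
case: axm => _ [[mu mu1 gE]|[n n2 gE]].
  exists (- mu), 0; split=> [|z z0]; first by rewrite lerNr.
  rewrite /sqrtg gE// mul0r expR0 mulr1.
  rewrite (_ : -2 * mu = - mu * 2); last by ring.
  by rewrite powRrM powR_mulrn ?powR_ge0// sqrtr_sqr ger0_norm ?powR_ge0.
exists (n - 1)%:R, (- 4^-1); split=> [|z z0]; first by rewrite ler1n subn_gt0.
rewrite /sqrtg gE// /enorm sqr_sqrtr ?dotv_ge0// powR_mulrn//.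
rewrite (_ : - (2^-1 * dotv z z) = (- 4^-1 * dotv z z) * 2%:R); last by field.
rewrite expRM_natr mulnC exprM -exprMn sqrtr_sqr ger0_norm//.
by rewrite mulr_ge0 ?exprn_ge0 ?expR_ge0.
Qed.

Lemma axis_metric_H : H = [set z | 0 < dotv z e1].
Proof. by case: axm. Qed.

Lemma sqrtg_axis z : dotv z e1 = 0 -> sqrtg g z = 0.
Proof.
move=> z0; have [p [c [p1 ->]]] := axis_metric_sqrtg; last by rewrite z0.
by rewrite z0 powR0 ?mul0r// gt_eqF// (lt_le_trans ltr01).
Qed.

(** The points z + s e1 with small s > 0 approach z from inside H. *)
Lemma within_axis_proper z : dotv z e1 = 0 -> ProperFilter (within H (nbhs z)).
Proof.
move=> z0; apply: Build_ProperFilter_ex => P zP.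
have l : (z + s *: e1) @[s --> 0^'+] --> z.
  have l : (z + s *: e1) @[s --> 0^'+] --> z + 0 *: e1.
    apply: cvgD; first exact: cvg_cst.
    by apply: cvgZ; [exact: cvg_within|exact: cvg_cst].
  by rewrite scale0r addr0 in l.
have [s [/= sP s0]] : exists s : R, (H (z + s *: e1) -> P (z + s *: e1)) /\ 0 < s.
  have lP : \forall s \near (0 : R)^'+, H (z + s *: e1) -> P (z + s *: e1).
    exact: (l [set y | H y -> P y] zP).
  apply: (@filter_ex _ (0 : R)^'+); near=> s; split=> //.
  by near: s; exact: lP.
exists (z + s *: e1); apply: sP; rewrite axis_metric_H/= dotvDl z0 add0r.
by rewrite dotvZl dotv_bvec mxE !eqxx mulr1.
Unshelve. all: by end_near. Qed.

Lemma dotv_e1_cvg_axis z : dotv z e1 = 0 ->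
  dotv y e1 @[y --> within H (nbhs z)] --> (0 : R)^'+.
Proof.
move=> z0 A A0.
have l : dotv y e1 @[y --> z] --> (0 : R).
  rewrite -z0; under eq_fun do rewrite dotv_e1.
  by rewrite dotv_e1; exact: coord_continuous.
have lA : \forall y \near z, 0 < dotv y e1 -> A (dotv y e1) by exact: (l _ A0).
suff : \forall y \near z, H y -> A (dotv y e1) by [].
by apply: filterS lA => y + Hy; apply; move: Hy; rewrite axis_metric_H.
Qed.

Lemma powR_cvg_at0 (p : R) : 0 <= p ->
  a `^ p @[a --> 0^'+] --> ((p == 0)%:R : R).
Proof.
rewrite le_eqVlt eq_sym => /orP[/eqP ->|p0]; last by rewrite gt_eqF//; exact: powR_cvg0.
by rewrite eqxx; under eq_fun do rewrite powRr0; exact: cvg_cst.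
Qed.

Lemma expR_dotv_cvg (c : R) z :
  expR (c * dotv y y) @[y --> within H (nbhs z)] --> expR (c * dotv z z).
Proof.
apply: cvg_within_filter.
apply: (@cvg_comp _ _ _ (fun y => c * dotv y y) expR _ _ _ _ (@continuous_expR _ _)).
apply: cvgM; first exact: cvg_cst.
by apply: cvg_dotv => i; exact: coord_continuous.
Qed.

Lemma sqrtg_cvg_axis z : dotv z e1 = 0 ->
  sqrtg g y @[y --> within H (nbhs z)] --> sqrtg g z.
Proof.
move=> z0; rewrite sqrtg_axis//; have [p [c [p1 gE]]] := axis_metric_sqrtg.
have l : dotv y e1 `^ p * expR (c * dotv y y) @[y --> within H (nbhs z)] --> 0.
  rewrite -(mul0r (expR (c * dotv z z))).
  apply: (@cvgM _ _ (within H (nbhs z)) _); last exact: expR_dotv_cvg.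
  exact: (cvg_comp _ (fun a : R => a `^ p) (dotv_e1_cvg_axis z0)
    (powR_cvg0 (lt_le_trans ltr01 p1))).
apply: (@cvg_near_eq _ _ (within H (nbhs z))) l; rewrite near_withinE.
by near=> y => Hy; rewrite gE//; move: Hy; rewrite axis_metric_H/= => /ltW.
Unshelve. all: by end_near. Qed.

Lemma derive_sqrtg_axis_metric (p c : R) y v : H y ->
  (forall z, 0 <= dotv z e1 ->
    sqrtg g z = dotv z e1 `^ p * expR (c * dotv z z)) ->
  'D_v (sqrtg g) y =
    dotv y e1 `^ p * (expR (c * dotv y y) * (c * (2 * dotv y v))) +
    expR (c * dotv y y) * (p * dotv y e1 `^ (p - 1) * dotv v e1).
Proof.
move=> Hy gE; have y0 : 0 < dotv y e1 by move: Hy; rewrite axis_metric_H.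
have d_coord i : is_derive y v (fun z : 'rV[R]_2 => z ord0 i) (v ord0 i).
  have l : h^-1 *: ((h *: v + y) ord0 i - y ord0 i) @[h --> (0 : R)^'] --> v ord0 i.
    apply: cvg_near_cst; near=> h; rewrite !mxE addrK.
    by rewrite scalerA mulVf ?scale1r//; near: h; exact: nbhs_dnbhs_neq.
  by split; [apply/cvg_ex; exists (v ord0 i)|exact: cvg_lim].
have d1 : is_derive y v (fun z : 'rV[R]_2 => dotv z e1) (dotv v e1).
  by under eq_fun do rewrite dotv_e1; rewrite dotv_e1; exact: d_coord.
have d2 : is_derive y v (fun z : 'rV[R]_2 => c * dotv z z) (c * (2 * dotv y v)).
  have ds := is_derive_sum (fun i => is_deriveM (d_coord i) (d_coord i)).
  have -> : (fun z : 'rV[R]_2 => c * dotv z z) =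
      c \*: \sum_(i < 2) ((fun z : 'rV[R]_2 => z ord0 i) * (fun z => z ord0 i)).
    by apply/funext => u; rewrite /= fct_sumE.
  apply: is_derive_eq; congr (_ * _); rewrite mulr_sumr.
  by apply: eq_bigr => i _; rewrite -mulr2n mulr_natl.
have dp := is_derive_chain d1 (is_derive1_powR p y0).
have dx := is_derive_chain d2 (is_derive_expR _).
have d := is_deriveM dp dx.
suff near_y : \near y, dotv y e1 `^ p * expR (c * dotv y y) = sqrtg g y.
  by have [_ ->] := near_eq_is_derive near_y d.
near=> u; rewrite gE//; suff : H u by rewrite axis_metric_H => /ltW.
by near: u; exact: open_nbhs_nbhs.
Unshelve. all: by end_near. Qed.

(** In the product rule x^p is multiplied by bounded factors and tends to 0,
    while p x^(p - 1) survives in the limit only in the direction normal to the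
    axis, and only if p = 1; hence the tangential component is 0. *)
Lemma derive_sqrtg_cvg_axis z i : dotv z e1 = 0 -> exists l : R,
  'D_(bvec i) (sqrtg g) y @[y --> within H (nbhs z)] --> l /\ (i != ord0 -> l = 0).
Proof.
move=> z0; have [p [c [p1 gE]]] := axis_metric_sqrtg.
have p_gt0 : 0 < p by rewrite (lt_le_trans ltr01).
have pow_cvg q : 0 <= q ->
    dotv y e1 `^ q @[y --> within H (nbhs z)] --> ((q == 0)%:R : R).
  by move=> q0; exact: (cvg_comp _ (fun a : R => a `^ q) (dotv_e1_cvg_axis z0) (powR_cvg_at0 q0)).
exists ((p == 0)%:R * (expR (c * dotv z z) * (c * (2 * dotv z (bvec i)))) +
    expR (c * dotv z z) * (p * (p - 1 == 0)%:R * dotv (bvec i) e1)); split; last first.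
  by move=> /negPf i0; rewrite gt_eqF// mul0r dotv_e1 mxE [ord0 == i]eq_sym i0 andbF !mulr0 addr0.
pose F := within H (nbhs z); have FF : Filter F by exact: within_filter.
apply: (@cvg_near_eq _ _ F); last first.
  apply: (@cvgD _ _ _ F).
    apply: (@cvgM _ _ F); first exact: pow_cvg (ltW p_gt0).
    apply: (@cvgM _ _ F); first exact: expR_dotv_cvg.
    apply: (@cvgM _ _ F); first exact: cvg_cst.
    apply: (@cvgM _ _ F); first exact: cvg_cst.
    apply: (@cvg_dotv _ _ F) => j; last exact: cvg_cst.
    by apply: cvg_within_filter; exact: coord_continuous.
  apply: (@cvgM _ _ F); first exact: expR_dotv_cvg.
  apply: (@cvgM _ _ F); last exact: cvg_cst.
  apply: (@cvgM _ _ F); first exact: cvg_cst.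
  by apply: pow_cvg; rewrite subr_ge0.
rewrite near_withinE; near=> y => Hy.
by rewrite (derive_sqrtg_axis_metric _ Hy gE).
Unshelve. all: by end_near. Qed.

End axis.

Section metric.
Context {R : realType}.
Variables (H : set 'rV[R]_2) (g : 'rV[R]_2 -> R).
Hypotheses (openH : open H) (g_gt0 : forall z, H z -> 0 < g z).
Hypothesis (g_smooth : smooth_on H g).

Lemma sqrtg_cvg z : admissible H g z ->
  sqrtg g y @[y --> within H (nbhs z)] --> sqrtg g z.
Proof.
case=> [Hz|[axm z0]]; last exact: sqrtg_cvg_axis.
apply: cvg_within_filter.
exact: differentiable_continuous (sqrtg_differentiable g_gt0 g_smooth Hz).
Qed.

Lemma gradient_cvg z i : admissible H g z ->
  gradient H (sqrtg g) y ord0 i @[y --> within H (nbhs z)] -->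
    gradient H (sqrtg g) z ord0 i.
Proof.
move=> adm; apply: gradient_sqrtg_cvg => //; case: adm => [Hz|[axm z0]].
  apply/cvg_ex; exists ('D_(bvec i) (sqrtg g) z); apply: cvg_within_filter.
  exact: (derive_sqrtg_cvg openH g_gt0 g_smooth Hz).
have [l [lP _]] := derive_sqrtg_cvg_axis openH axm i z0.
by apply/cvg_ex; exists l.
Qed.

Lemma gradient_axis z i : axis_metric H g -> dotv z e1 = 0 -> i != ord0 ->
  gradient H (sqrtg g) z ord0 i = 0.
Proof.
move=> axm z0 i0; have PF := within_axis_proper axm z0.
have [l [lP l0]] := derive_sqrtg_cvg_axis openH axm i z0.
by rewrite mxE -(l0 i0); exact: cvg_lim.
Qed.

Variables (T t : R).
Hypothesis tT : 0 < t <= T.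

(** The chain rule at an interior point. On the axis both sides are 0: the weight
    vanishes along the whole trajectory, the velocity is tangential and the
    gradient is normal. *)
Lemma tquot_sqrtg (f : R -> 'rV[R]_2) (v : 'rV[R]_2) : tquot T f t --> v ->
  H (f t) \/ (axis_metric H g /\ forall s, 0 < s <= T -> dotv (f s) e1 = 0) ->
  tquot T (fun s => sqrtg g (f s)) t --> dotv (gradient H (sqrtg g) (f t)) v.
Proof.
move=> fv [Hf|[axm f0]].
  have dF := is_derive_ext tT fv.
  set F := tangent_ext _ _ _ _ in dF.
  have Ft : F t = f t by exact: tangent_ext_t.
  have dg : differentiable (sqrtg g) (F t).
    by rewrite Ft; exact: sqrtg_differentiable Hf.
  have FD : differentiable F t by apply/derivable1_diffP; case: dF.
  have d : is_derive t 1 (sqrtg g \o F) (dotv (gradient H (sqrtg g) (f t)) v).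
    split; first by apply/derivable1_diffP; exact: differentiable_comp.
    rewrite deriveE; last exact: differentiable_comp.
    rewrite diff_comp//=; have [_ DF] := dF.
    rewrite -[in X in 'd _ _ X]deriveE// DF -deriveE// Ft.
    rewrite derive_sum_bvec; last by rewrite -Ft.
    apply: eq_bigr => i _; rewrite mulrC; congr (_ * _).
    by rewrite (gradient_sqrtgE openH g_gt0 g_smooth).
  apply: (tquot_restrict tT d) => s /andP[/ltW s0 sT].
  by rewrite /= /F tangent_extE// s0.
have v0 : v ord0 ord0 = 0.
  have := tquot_coord tT (i := ord0) fv.
  have : tquot T (fun s => f s ord0 ord0) t --> (0 : R).
    apply: (@tquot_restrict _ _ _ tT _ (cst 0)) => s sT.
    by rewrite -dotv_e1 f0.
  have PF := tquot_proper tT.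
  by move=> l1 l2; exact: (cvg_unique _ l2 l1).
have -> : dotv (gradient H (sqrtg g) (f t)) v = 0.
  apply: big1 => i _; have [->|i0] := eqVneq i ord0; first by rewrite v0 mulr0.
  by rewrite gradient_axis ?mul0r ?f0.
apply: (@tquot_restrict _ _ _ tT _ (cst 0)) => s sT.
by rewrite (sqrtg_axis axm)// f0.
Qed.

End metric.

(** * The semidiscrete flow *)

Section solution.
Context {R : realType}.
Variables (H : set 'rV[R]_2) (g : 'rV[R]_2 -> R).
Variables (k : curve_kind) (d0 d1 d2 dD : set R) (J : nat) (T : R).
Variables (X : R -> R -> 'rV[R]_2) (kappa : R -> R -> R).
Hypotheses (openH : open H) (g_gt0 : forall z, H z -> 0 < g z).
Hypothesis (g_smooth : smooth_on H g).
Hypothesis (part : bd_partition k d0 d1 d2 dD).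
Hypothesis (axis : d0 !=set0 -> axis_metric H g).
Hypothesis (J_gt0 : (0 < J)%N).
Hypothesis (sol : scheme_solution H g k d0 d1 d2 dD J T X kappa).

Lemma d0_boundary rho : d0 rho -> rho = 0 \/ rho = 1.
Proof.
move=> h; case: part => + _ _; move=> /seteqP[_ /(_ rho)] /=.
have : (d0 `|` d1 `|` d2 `|` dD) rho by do 3!left.
by move=> /[swap] /[apply]; case: (k).
Qed.

Lemma d0_itv rho : d0 rho -> rho \in `[0, 1].
Proof. by move=> /d0_boundary[] ->; rewrite in_itv/= ?lexx ?ler01. Qed.

Lemma Xt_tquot t rho : 0 < t <= T -> rho \in `[0, 1] ->
  tquot T (fun s => X s rho) t --> Xt T X t rho.
Proof. by move=> tT r01; exact: (sol_diff sol tT r01). Qed.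

(** The velocity lies in the space of functions whose first component vanishes
    on d0, and X attains its initial value, which is on the axis. *)
Lemma d0_axis t rho : 0 < t <= T -> d0 rho -> dotv (X t rho) e1 = 0.
Proof.
move=> tT d0r; rewrite dotv_e1.
have [_ /(_ rho d0r)] := sol_init sol; rewrite dotv_e1 => <-.
apply: (@tquot0_constant _ T t (fun s => X s rho ord0 ord0)) => // [s sT|].
  have -> : (0 : R) = Xt T X s rho ord0 ord0.
    by have [[_ /(_ rho d0r)]] := sol_Xt sol sT; rewrite dotv_e1.
  by apply: tquot_coord => //; apply: Xt_tquot => //; exact: d0_itv.
by apply: cvg_coord; apply: (sol_init_cont sol); exact: d0_itv.
Qed.

Lemma curve_position t rho : 0 < t <= T -> rho \in `[0, 1] ->
  H (X t rho) \/
  (axis_metric H g /\ forall s, 0 < s <= T -> dotv (X s rho) e1 = 0).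
Proof.
move=> tT r01; have [d0r|nd0r] := pselect (d0 rho); last first.
  by left; exact: (sol_in_H sol tT r01 nd0r).
by right; split=> [|s sT]; [apply: axis; exists rho|exact: d0_axis].
Qed.

Variables (t : R).
Hypothesis tT : 0 < t <= T.

Lemma curve_admissible rho : rho \in `[0, 1] -> admissible H g (X t rho).
Proof.
by move=> r01; case: (curve_position tT r01) => [|[axm /(_ t tT)]]; [left|right].
Qed.

Lemma elt_in_H j rho : (j < J)%N -> rho \in `]node J j, node J j.+1[ ->
  H (X t rho).
Proof.
move=> jJ /(elt_itv01 J_gt0 jJ)/andP[r0 r1]; apply: (sol_in_H sol tT).
  by rewrite in_itv/= !ltW.
by move=> /d0_boundary[] E; move: r0 r1; rewrite E ltxx.
Qed.

Lemma slope_gt0 j : (j < J)%N -> 0 < enorm (slope J j (X t)).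
Proof.
move=> jJ; pose m : R := (node J j + node J j.+1) / 2.
have mj : m \in `]node J j, node J j.+1[.
  by rewrite in_itv/= !midf_lt// node_ltS.
have := sol_regular sol tT jJ mj.
by rewrite /speed (vecVh_derive1 J_gt0 jJ (sol_X sol tT) mj).
Qed.

(** The nodes may be on the axis, but the interiors of the elements stay in H;
    so values at a node are approached from inside H, the mode of convergence in
    which the weight and its gradient are continuous. *)
Lemma curve_within_cvg j p F : (j < J)%N -> elt_side J j p F ->
  X t rho @[rho --> F] --> within H (nbhs (X t p)).
Proof.
move=> jJ side A; have [PF _ near_elt _] := side.
move=> /(vecVh_cvg J_gt0 jJ (sol_X sol tT) side) /= XA.
rewrite nbhs_simpl /=.
by apply: filterS2 near_elt XA => r /(elt_in_H jJ) HX /= /(_ HX).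
Qed.

Lemma elt_derive1 j p F : (j < J)%N -> elt_side J j p F ->
  \forall rho \near F, slope J j (X t) = derive1 (X t) rho.
Proof.
move=> jJ [PF _ near_elt _]; apply: filterS near_elt => r rj.
by rewrite (vecVh_derive1 J_gt0 jJ (sol_X sol tT) rj).
Qed.

Lemma sqrtg_curve_cvg j p F : (j < J)%N -> elt_side J j p F ->
  sqrtg g (X t rho) @[rho --> F] --> sqrtg g (X t p).
Proof.
move=> jJ side; apply: cvg_comp (curve_within_cvg jJ side) _.
by apply: sqrtg_cvg => //; apply: curve_admissible; exact: elt_side_itv01 side.
Qed.

Lemma Lhg_nodal : Lhg J g (X t) = 2^-1 * J%:R^-1 *
  \sum_(0 <= j < J)
    (sqrtg g (X t (node J j.+1)) * enorm (slope J j (X t)) +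
     sqrtg g (X t (node J j)) * enorm (slope J j (X t))).
Proof.
rewrite /Lhg /mls (@ml_nodal _ _ J_gt0 _
  (fun j p => sqrtg g (X t p) * enorm (slope J j (X t))))//.
move=> j p F jJ side; have [PF _ _ _] := side.
apply: cvgM; first exact: sqrtg_curve_cvg side.
apply: cvg_near_cst; apply: filterS (elt_derive1 jJ side) => r ar.
by rewrite /speed ar.
Qed.

Lemma gradient_term_nodal (eta : R -> 'rV[R]_2) : vecVh k J eta ->
  mlv J (fun rho => gradient H (sqrtg g) (X t rho))
        (fun rho => speed (X t) rho *: eta rho) =
  2^-1 * J%:R^-1 * \sum_(0 <= j < J)
    (enorm (slope J j (X t)) *
       dotv (gradient H (sqrtg g) (X t (node J j.+1))) (eta (node J j.+1)) +
     enorm (slope J j (X t)) *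
       dotv (gradient H (sqrtg g) (X t (node J j))) (eta (node J j))).
Proof.
move=> etaV; rewrite /mlv (@ml_nodal _ _ J_gt0 _
  (fun j p => enorm (slope J j (X t)) *
     dotv (gradient H (sqrtg g) (X t p)) (eta p)))//.
move=> j p F jJ side; have [PF _ _ _] := side.
apply: (@cvg_near_eq _ _ F _ _
  (fun rho => enorm (slope J j (X t)) *
     dotv (gradient H (sqrtg g) (X t rho)) (eta rho))).
  by apply: filterS (elt_derive1 jJ side) => r ar; rewrite dotvZr /speed ar.
apply: cvgM; first exact: cvg_cst.
apply: cvg_dotv => i; last exact: (Vh_cvg J_gt0 jJ (etaV i) side).
have adm : admissible H g (X t p).
  by apply: curve_admissible; exact: elt_side_itv01 side.
exact: (cvg_comp _ (fun z => gradient H (sqrtg g) z ord0 i)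
  (curve_within_cvg jJ side)
  (gradient_cvg openH g_gt0 g_smooth adm)).
Qed.

Lemma stiffness_term_nodal (eta : R -> 'rV[R]_2) : vecVh k J eta ->
  mlv J (fun rho => sqrtg g (X t rho) *: derive1 (X t) rho)
        (fun rho => (speed (X t) rho)^-1 *: derive1 eta rho) =
  2^-1 * J%:R^-1 * \sum_(0 <= j < J)
    (sqrtg g (X t (node J j.+1)) * ((enorm (slope J j (X t)))^-1 *
       dotv (slope J j (X t)) (slope J j eta)) +
     sqrtg g (X t (node J j)) * ((enorm (slope J j (X t)))^-1 *
       dotv (slope J j (X t)) (slope J j eta))).
Proof.
move=> etaV; rewrite /mlv (@ml_nodal _ _ J_gt0 _
  (fun j p => sqrtg g (X t p) * ((enorm (slope J j (X t)))^-1 *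
       dotv (slope J j (X t)) (slope J j eta))))//.
move=> j p F jJ side; have [PF _ near_elt _] := side.
apply: (@cvg_near_eq _ _ F _ _
  (fun rho => sqrtg g (X t rho) * ((enorm (slope J j (X t)))^-1 *
       dotv (slope J j (X t)) (slope J j eta)))).
  apply: filterS2 near_elt (elt_derive1 jJ side) => r rj ar.
  by rewrite [RHS]dotvZl [dotv _ (_^-1 *: _)]dotvZr /speed -ar (vecVh_derive1 J_gt0 jJ etaV rj).
by apply: cvgM; [exact: sqrtg_curve_cvg side|exact: cvg_cst].
Qed.

End solution.

Section energy.
Context {R : realType}.
Variables (H : set 'rV[R]_2) (g : 'rV[R]_2 -> R).
Variables (k : curve_kind) (d0 d1 d2 dD : set R) (J : nat) (T : R).
Variables (X : R -> R -> 'rV[R]_2) (kappa : R -> R -> R).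
Hypotheses (openH : open H) (g_gt0 : forall z, H z -> 0 < g z).
Hypothesis (g_smooth : smooth_on H g).
Hypothesis (part : bd_partition k d0 d1 d2 dD).
Hypothesis (axis : d0 !=set0 -> axis_metric H g).
Hypothesis (J_gt0 : (0 < J)%N).
Hypothesis (sol : scheme_solution H g k d0 d1 d2 dD J T X kappa).
Variables (t : R).
Hypothesis tT : 0 < t <= T.

(** Element by element this is the product rule for weight times length of the
    slope. The velocity belongs to the finite element space, so the time
    derivative of the slope of X is the slope of X_t. *)
Lemma Lhg_tquot : tquot T (fun s => Lhg J g (X s)) t -->
  mlv J (fun rho => gradient H (sqrtg g) (X t rho))
        (fun rho => speed (X t) rho *: Xt T X t rho) +
  mlv J (fun rho => sqrtg g (X t rho) *: derive1 (X t) rho)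
        (fun rho => (speed (X t) rho)^-1 *: derive1 (Xt T X t) rho).
Proof.
have [[XtV _] _ _ _] := sol_Xt sol tT.
rewrite (gradient_term_nodal openH g_gt0 g_smooth part axis J_gt0 sol tT XtV).
rewrite (stiffness_term_nodal g_gt0 g_smooth part axis J_gt0 sol tT XtV).
rewrite -mulrDr -big_split /= big_mkord.
have W_tquot p : p \in `[0, 1] -> tquot T (fun s => sqrtg g (X s p)) t -->
    dotv (gradient H (sqrtg g) (X t p)) (Xt T X t p).
  move=> p01; apply: (tquot_sqrtg openH g_gt0 g_smooth tT).
    exact: (Xt_tquot sol tT p01).
  exact: (curve_position part axis sol tT p01).
have slope_tquot j : (j < J)%N -> tquot T (fun s => enorm (slope J j (X s))) t -->
    (enorm (slope J j (X t)))^-1 * dotv (slope J j (X t)) (slope J j (Xt T X t)).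
  move=> jJ; apply: (tquot_enorm tT); first exact: (slope_gt0 J_gt0 sol tT jJ).
  apply: (tquotZ tT); rewrite -scaleN1r.
  under [X in tquot T X]eq_fun do rewrite -scaleN1r.
  apply: (tquotD tT); last apply: (tquotZ tT).
    by apply: (Xt_tquot sol tT); exact: node_itv.
  by apply: (Xt_tquot sol tT); apply: node_itv => //; exact: ltnW.
have L_tquot := tquotZ tT (c := 2^-1 * J%:R^-1) (tquot_sum tT (fun i : 'I_J =>
  tquotD tT
   (tquotM tT (W_tquot _ (node_itv J_gt0 (ltn_ord i))) (slope_tquot i (ltn_ord i)))
   (tquotM tT (W_tquot _ (node_itv J_gt0 (ltnW (ltn_ord i)))) (slope_tquot i (ltn_ord i))))).
have dL := is_derive_ext tT L_tquot.
(* D is the derivative delivered by the product rule on every element. *)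
set D := (X in is_derive _ _ _ X) in dL.
rewrite (_ : _ * _ = D); last first.
  rewrite /D; congr (_ * _); apply: eq_bigr => i _; ring.
apply: (tquot_restrict tT dL) => s sT.
rewrite tangent_extE; last by case/andP: sT => /ltW -> ->.
by rewrite (Lhg_nodal g_gt0 g_smooth part axis J_gt0 sol sT) big_mkord.
Qed.

(** The first equation is tested with kappa, the second one with X_t. *)
Lemma energy_identity :
  mls J (fun rho => sqrtg g (X t rho) * kappa t rho)
        (fun rho => kappa t rho * speed (X t) rho) +
  (mlv J (fun rho => gradient H (sqrtg g) (X t rho))
        (fun rho => speed (X t) rho *: Xt T X t rho) +
  mlv J (fun rho => sqrtg g (X t rho) *: derive1 (X t) rho)
        (fun rho => (speed (X t) rho)^-1 *: derive1 (Xt T X t) rho)) = 0.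
Proof.
rewrite -(sol_normal sol tT (sol_kappa sol tT)) addrA.
rewrite -(sol_curvature sol tT (sol_Xt sol tT)); do 2!congr (_ + _).
congr (ml J _); apply/funext => r; rewrite !(dotvZl, dotvZr).
by rewrite [dotv (nu _ _) _]dotvC; ring.
Qed.

End energy.

Theorem theorem3p1 (R : realType) (H : set 'rV[R]_2) (g : 'rV[R]_2 -> R)
    (k : curve_kind) (d0 d1 d2 dD : set R) (J : nat) (T : R)
    (X : R -> R -> 'rV[R]_2) (kappa : R -> R -> R)
    (domH : is_domain H)
    (g_gt0 : forall z, H z -> 0 < g z)
    (g_smooth : smooth_on H g)
    (part : bd_partition k d0 d1 d2 dD)
    (axis : d0 !=set0 -> axis_metric H g)
    (J_ge3 : (3 <= J)%N)
    (T_gt0 : 0 < T)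
    (sol : scheme_solution H g k d0 d1 d2 dD J T X kappa) :
  forall t : R, 0 < t <= T ->
    tderivable T (fun s => Lhg J g (X s)) t /\
    tderiv T (fun s => Lhg J g (X s)) t +
      mls J (fun rho => sqrtg g (X t rho) * kappa t rho)
            (fun rho => kappa t rho * speed (X t) rho) = 0.
Proof.
move=> t tT; have [openH _ _] := domH; have J_gt0 : (0 < J)%N by exact: ltn_trans J_ge3.
have dL := Lhg_tquot openH g_gt0 g_smooth part axis J_gt0 sol tT.
have [dervL ->] := tquot_uniq tT dL.
by split=> //; rewrite addrC; exact: (energy_identity sol tT).
Qed.
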